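(* Let $N\ge2$ be an integer and $\lambda<0$. Consider the equation $$-w''+(N-2)w'+(N-1)w=\frac{N-1}{2}e^{-t}w^2+\lambda e^{(N-3)t}\int_0^{e^{-t}}g(s)\,ds \qquad (\ast)$$ and the three problems: (D) $w\in C^2([0,\infty))$ solves $(\ast)$ for $t\ge0$ with $w(0)=0$, $\lim_{t\to\infty}w(t)=0$, where $g\in L^1([0,1])$ and $\lim_{t\to\infty}e^{(N-3)t}\int_0^{e^{-t}}g(s)\,ds=0$; (Nav) $w\in C^2([0,\infty))$ solves $(\ast)$ for $t\ge0$ with $w'(0)-(N-1)w(0)=0$, $\lim_{t\to\infty}w(t)=0$, with $g$ as in (D); (E) $w\in C^2(\mathbb{R})$ solves $(\ast)$ for $t\in\mathbb{R}$ with $\lim_{t\to\pm\infty}w(t)=0$, where $g\in L^1([0,\infty))$ and $\lim_{t\to\pm\infty}e^{(N-3)t}\int_0^{e^{-t}}g(s)\,ds=0$. Assume in each case that $g\ge0$ a.e. and $\operatorname{ess\,sup}g>0$. Then each of the problems (D), (Nav), (E) has at least one solution.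
   Context: These are the radial Dirichlet, Navier and entire problems for $\Delta^2u=S_2[u]+\lambda f$ ($S_2$ the sum of $2\times2$ principal minors of the Hessian), obtained via $v=u'$, $w(t)=-v(e^{-t})$. *)

(* Defs.v *)
From HB Require Import structures.
From mathcomp Require Import all_boot all_order all_algebra.
From mathcomp Require Import all_classical all_reals all_analysis ess_sup_inf.
Set Implicit Arguments. Unset Strict Implicit. Unset Printing Implicit Defensive.
Import Order.TTheory GRing.Theory Num.Theory.
Import numFieldNormedType.Exports.
Local Open Scope classical_set_scope.
Local Open Scope ring_scope.

Section defs.
Variable R : realType.
Local Notation mu := (@lebesgue_measure R).

Definition Gterm (N : nat) (g : R -> R) (t : R) : R :=
  expR ((N%:R - 3) * t) * (\int[mu]_(s in `[0, expR (- t)]) g s).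

Definition ode_at (N : nat) (lam : R) (g : R -> R) (w w1 w2 : R -> R) (t : R) : Prop :=
  - w2 t + (N%:R - 2) * w1 t + (N%:R - 1) * w t =
  (N%:R - 1) / 2 * expR (- t) * (w t) ^+ 2 + lam * Gterm N g t.

(* w in C^2([0,oo)) with w' = w1, w'' = w2: differentiable twice on (0,oo),
   and w, w', w'' extend continuously to [0,oo). *)
Definition C2_halfline (w w1 w2 : R -> R) : Prop :=
  (forall t : R, 0 < t -> is_derive t 1 w (w1 t) /\ is_derive t 1 w1 (w2 t)) /\
  {within `[0, +oo[, continuous w} /\
  {within `[0, +oo[, continuous w1} /\
  {within `[0, +oo[, continuous w2}.

Definition C2_line (w w1 w2 : R -> R) : Prop :=
  (forall t : R, is_derive t 1 w (w1 t) /\ is_derive t 1 w1 (w2 t)) /\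
  continuous w2.

Definition g_hyp (D : set R) (mD : measurable D) (g : R -> R) : Prop :=
  mu.-integrable D (EFin \o g) /\
  {ae mu, forall x, D x -> 0 <= g x} /\
  (0 < ess_sup (mrestr mu mD) (EFin \o g))%E.

End defs.

Lemma measurable_01 (R : realType) : measurable (`[0, 1] : set R).
Proof. exact: measurable_itv. Qed.

Lemma measurable_0oo (R : realType) : measurable (`[0, +oo[ : set R).
Proof. exact: measurable_itv. Qed.

(* Main.v *)
Require Import Defs.
From HB Require Import structures.
From mathcomp Require Import all_boot all_order all_algebra.
From mathcomp Require Import all_classical all_reals all_analysis ess_sup_inf measurable_realfun.
From mathcomp Require Import ring lra.
Import Order.TTheory GRing.Theory Num.Theory.
Import numFieldNormedType.Exports.
Local Open Scope classical_set_scope.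
Local Open Scope ring_scope.

(* With p = N - 1, a = p / 2 and u = -w the problem becomes
     -u'' + (p - 1) u' + p u + a exp(-t) u^2 = h,   h = -lam G >= 0,
   and the nonlinearity is increasing for u >= 0, so a comparison principle holds.
   On a bounded interval [al, be] with u(be) = 0 and a homogeneous Robin condition
   sg u'(al) = tau u(al) a contracting iteration gives a solution with
   0 <= u <= sup h / p. Explicit barriers built from the exponentials exp(-t) and
   exp(p t), which are annihilated by the linear part, show that these solutions are
   uniformly small near the infinite ends. Comparing the solutions on two nested
   intervals, they therefore form a uniformly Cauchy sequence as the intervals
   exhaust the half-line or the line, and the limit solves the problem. *)

(** * Comparison principle *)

Section RealAnalysis.
Context {R : realType}.
Implicit Types (u v f g : R -> R) (a b t : R).

(** The sign of [lam] is what makes the argument global: it gives h >= 0, hence nonnegative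
    solutions, and for x >= 0 the map x -> p x + a exp(-t) x^2 is strictly increasing, so that the
    comparison arguments and the bound hold whatever the size of [lam]. The obstacle is the weight
    exp(-t), unbounded as t tends to -oo: the contraction factor of the iteration depends on the
    supremum of the weight on the interval, so the iteration cannot be run on the whole line. The
    passage to the limit therefore relies only on comparison, whose estimates use that the weight is
    nonnegative and not how large it is. To see that a uniform limit is C^2, the quadratic term
    evaluated at that limit is moved into the source, and the limit is identified with the exact
    solution of the resulting linear problem. *)

Lemma is_derive_line_continuous {f df : R -> R} :
  (forall t, is_derive t 1 f (df t)) -> continuous f.
Proof.
move=> fdf t; apply/differentiable_continuous/derivable1_diffP.
exact: (@ex_derive _ _ _ _ _ _ _ (fdf t)).
Qed.

Lemma is_derive_add {f g t a b} : is_derive t 1 f a -> is_derive t 1 g b ->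
  is_derive t 1 (fun x => f x + g x) (a + b).
Proof. exact: is_deriveD. Qed.

Lemma is_derive_scale k {f t a} : is_derive t 1 f a ->
  is_derive t 1 (fun x => k * f x) (k * a).
Proof. exact: is_deriveZ. Qed.

Lemma is_derive_mul {f g t a b} : is_derive t 1 f a -> is_derive t 1 g b ->
  is_derive t 1 (fun x => f x * g x) (f t * b + g t * a).
Proof. exact: is_deriveM. Qed.

Lemma is_derive_expRM k t :
  is_derive t 1 (fun x => expR (k * x)) (k * expR (k * t)).
Proof.
apply: (is_derive_eq (is_derive1_comp (is_derive_expR _)
  (is_derive_scale k (is_derive_id t 1)))).
by rewrite mulr1 mulrC.
Qed.

Lemma is_derive_gt0_near {f a t} : is_derive t 1 f a -> 0 < a ->
  \forall s \near t^'+, f t < f s.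
Proof.
move=> /is_derive1_caratheodory[g [fg cg gt]] a0; rewrite near_withinE.
have : \forall s \near t, 0 < g s by apply: (cvgr_gt _ cg); rewrite gt.
by apply: filterS => s gs ts; rewrite -subr_gt0 fg mulr_gt0// subr_gt0.
Qed.

(* A positive maximum of [u - v] cannot lie in the interior by the condition on
   critical points, nor at [al], where it would give [u1 al <= v1 al]; the Robin
   form of the condition at [al] covers both (D) and (Nav). *)
Lemma comparison_principle (al be sg tau : R) (u u1 u2 v v1 v2 : R -> R) :
  al < be -> 0 <= sg -> 0 < tau -> C2_line u u1 u2 -> C2_line v v1 v2 ->
  (forall t, al < t < be -> v t < u t -> u1 t = v1 t -> v2 t < u2 t) ->
  tau * (u al - v al) <= sg * (u1 al - v1 al) -> u be <= v be ->
  forall t, al <= t <= be -> u t <= v t.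
Proof.
move=> albe sg0 tau0 [du _] [dv _] crit bal bbe t tI.
pose z s := u s + -1 * v s; pose z1 s := u1 s + -1 * v1 s.
pose z2 s := u2 s + -1 * v2 s.
have dz (s : R) : is_derive s 1 z (z1 s).
  exact: is_derive_add (du s).1 (is_derive_scale _ (dv s).1).
have dz1 (s : R) : is_derive s 1 z1 (z2 s).
  exact: is_derive_add (du s).2 (is_derive_scale _ (dv s).2).
have [c cI cmax] : exists2 c, c \in `[al, be] &
    forall s, s \in `[al, be] -> z s <= z c.
  apply: EVT_max; first exact: ltW.
  exact/continuous_subspaceT/(is_derive_line_continuous dz).
have [zc|zc] := leP (z c) 0.
  by have := le_trans (cmax t tI) zc; rewrite /z mulN1r subr_le0.
have {cI}/andP[alc cbe] : al <= c <= be by [].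
have {}cbe : c < be.
  rewrite lt_neqAle cbe andbT; apply/eqP => cb; move: zc.
  by rewrite /z mulN1r subr_gt0 cb ltNge bbe.
have inI s : c < s -> s < be -> s \in `[al, be].
  by move=> cs sb; rewrite in_itv/= (le_trans alc (ltW cs)) (ltW sb).
have z1c : z1 c <= 0.
  rewrite leNgt; apply/negP => z1c.
  near c^'+ => s.
  have cs : c < s by near: s; exact: nbhs_right_gt.
  have : z c < z s by near: s; exact: is_derive_gt0_near (dz c) z1c.
  rewrite ltNge cmax// inI//; near: s; exact: nbhs_right_lt.
have {}alc : al < c.
  rewrite lt_neqAle alc andbT; apply/eqP => ac; move: zc z1c bal.
  rewrite -ac /z /z1 !mulN1r => zc z1c.
  apply/negP; rewrite -ltNge (@le_lt_trans _ _ 0)// ?mulr_gt0//.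
  exact: mulr_ge0_le0.
have {}z1c : z1 c = 0.
  have zc0 : is_derive c 1 z 0.
    apply: (@derive1_at_max _ z al be) => //; first exact: ltW.
    - by rewrite in_itv/= alc.
    - by move=> s sI; apply: cmax; exact: subset_itv_oo_cc sI.
  by rewrite -(@derive_val _ _ _ _ _ _ _ (dz c)) (@derive_val _ _ _ _ _ _ _ zc0).
have z2c : 0 < z2 c.
  rewrite /z2 mulN1r subr_gt0 crit ?alc//.
    by move: zc; rewrite /z mulN1r subr_gt0.
  by apply/eqP; rewrite -subr_eq0 -mulN1r; exact/eqP.
(* One-sided second-derivative test: [z1] vanishes at [c] and is positive just to its right, so by
   the mean value theorem [z] takes a value above its maximum. The point [s] below stays both in
   that neighbourhood and left of [be]. *)
have : \forall s \near c^'+, 0 < z1 s.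
  by rewrite -z1c; exact: is_derive_gt0_near (dz1 c) z2c.
rewrite near_withinE => /nbhs_ballP[e /= e0 ez].
pose s := c + Num.min e (be - c) / 2.
have m0 : 0 < Num.min e (be - c) by rewrite lt_min e0 subr_gt0.
have [me mb] : Num.min e (be - c) <= e /\ Num.min e (be - c) <= be - c.
  by rewrite !ge_min !lexx orbT.
have cs : c < s by rewrite /s; lra.
have sb : s < be by rewrite /s; lra.
have [y yI] := MVT cs (fun x _ => dz x)
  (continuous_subspaceT (is_derive_line_continuous dz)).
move: yI; rewrite in_itv/= => /andP[cy ys] zE.
have : 0 < z1 y.
  apply: ez => //=; rewrite /ball/= ltr0_norm ?subr_lt0//.
  by move: ys; rewrite /s; lra.
rewrite -(pmulr_lgt0 _ (_ : 0 < s - c)) ?subr_gt0// -zE subr_gt0.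
by rewrite ltNge cmax// inI.
Unshelve. all: by end_near. Qed.

End RealAnalysis.

(** * Linear two-point problems *)

Section LinearProblem.
Context {R : realType}.
Notation mu := (@lebesgue_measure R).

Lemma C2_line_axpy k {u u1 u2 v v1 v2 : R -> R} :
  C2_line u u1 u2 -> C2_line v v1 v2 ->
  C2_line (fun t => u t + k * v t) (fun t => u1 t + k * v1 t)
    (fun t => u2 t + k * v2 t).
Proof.
move=> [du cu] [dv cv]; split => [t|t].
  by split; [exact: is_derive_add (du t).1 (is_derive_scale _ (dv t).1)|
             exact: is_derive_add (du t).2 (is_derive_scale _ (dv t).2)].
by apply: cvgD; [exact: cu|apply: cvgM; [exact: cvg_cst|exact: cv]].
Qed.

Lemma C2_line_scale k {v v1 v2 : R -> R} : C2_line v v1 v2 ->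
  C2_line (fun t => k * v t) (fun t => k * v1 t) (fun t => k * v2 t).
Proof.
move=> [dv cv]; split => [t|t].
  by split; [exact: is_derive_scale _ (dv t).1|exact: is_derive_scale _ (dv t).2].
by apply: cvgM; [exact: cvg_cst|exact: cv].
Qed.

Lemma C2_line_cst (k : R) :
  C2_line (fun=> k) (fun=> 0) (fun=> 0).
Proof.
split=> [t|]; last exact: cst_continuous.
by split; exact: is_derive_cst.
Qed.

Lemma C2_line_expR (r : R) :
  C2_line (fun t => expR (r * t)) (fun t => r * expR (r * t))
    (fun t => r * (r * expR (r * t))).
Proof.
split=> [t|t].
  by split; last apply: is_derive_scale; exact: is_derive_expRM.
apply: cvgM; first exact: cvg_cst.
apply: cvgM; first exact: cvg_cst.
exact: is_derive_line_continuous (is_derive_expRM r) t.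
Qed.

Lemma continuous_primitive (f : R -> R) : continuous f ->
  exists F : R -> R, forall t : R, is_derive t 1 F (f t).
Proof.
move=> cf.
have itf (i : interval R) a b : [set` i] `<=` `[a, b] ->
    mu.-integrable [set` i] (EFin \o f).
  move=> iab; apply: (@integrableS _ _ _ mu `[a, b]) => //.
  apply: continuous_compact_integrable; first exact: segment_compact.
  exact: continuous_subspaceT.
(* This is the signed integral from 0 to [s]: for each sign of [s] one of the two domains is empty,
   and at 0 both are a point. *)
exists (fun s => \int[mu]_(x in `[0, s]) f x - \int[mu]_(x in `[s, 0]) f x) => t.
(* With a base point left of both [t] and 0, the signed integral near [t] is the integral from [c]
   up to an additive constant, and the fundamental theorem applies at the interior point [t]. *)
pose c := Num.min t 0 - 1.
have [ct c0] : c < t /\ c < 0.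
  have /andP[] : Num.min t 0 <= t /\ Num.min t 0 <= 0 by rewrite !ge_min !lexx orbT.
  by rewrite /c; lra.
apply: (@near_eq_is_derive _ _ _ (fun s => \int[mu]_(x in `[c, s]) f x -
  \int[mu]_(x in `[c, 0]) f x)).
  near=> s.
  have cs : c < s by near: s; exact: lt_nbhsr.
  have [s0|s0] := leP 0 s.
    rewrite (@Rintegral_itvB _ f (BLeft c) (BRight s))//; last 2 first.
      exact: (itf _ c s).
      by rewrite bnd_simp ltW.
    rewrite Rintegral_itv_obnd_cbnd; last exact: (itf _ 0 s (@subset_itv_oc_cc _ _ _ _)).
    suff -> : \int[mu]_(x in `[s, 0]) f x = 0 by rewrite subr0.
    move: s0; rewrite le_eqVlt => /predU1P[<-|s0].
      by rewrite set_itv1 Rintegral_set1.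
    by rewrite set_itv_ge ?Rintegral_set0// bnd_simp -ltNge.
  rewrite -opprB (@Rintegral_itvB _ f (BLeft c) (BRight 0))//; last 3 first.
    exact: (itf _ c 0).
    by rewrite bnd_simp ltW.
    by rewrite bnd_simp ltW.
  rewrite Rintegral_itv_obnd_cbnd; last exact: (itf _ s 0 (@subset_itv_oc_cc _ _ _ _)).
  suff -> : \int[mu]_(x in `[0, s]) f x = 0 by rewrite sub0r.
  by rewrite set_itv_ge ?Rintegral_set0// bnd_simp -ltNge.
have [dF F'] := @continuous_FTC1_closed R f c t (t + 1) (ltr_pwDr ltr01 (lexx _))
  (itf _ _ _ (@subset_refl _ _)) ct (cf t).
rewrite -[f t]subr0; apply: is_deriveB.
by rewrite -F' derive1E; exact: derivableP.
Unshelve. all: by end_near. Qed.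

Lemma first_order_solve (r : R) (f : R -> R) : continuous f ->
  exists y : R -> R, forall t : R, is_derive t 1 y (r * y t + f t).
Proof.
move=> cf.
have cE : continuous (fun t : R => expR (- r * t)).
  exact: is_derive_line_continuous (is_derive_expRM (- r)).
have [|F dF] := continuous_primitive (fun t => expR (- r * t) * f t).
  by move=> t; apply: cvgM; [exact: cE|exact: cf].
exists (fun t => expR (r * t) * F t) => t.
apply: (is_derive_eq (is_derive_mul (is_derive_expRM r t) (dF t))).
rewrite mulrA -expRD mulNr subrr expR0 mul1r addrC; congr (_ + _); ring.
Qed.

(** With D the derivative, the operator factors as -(D - r2)(D - r1), so two first-order equations
    suffice: p = u' - r1 u solves p' = r2 p - f. The second derivative then has an explicit
    continuous expression. *)
Lemma linear_particular (r1 r2 : R) (f : R -> R) : continuous f ->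
  exists u u1 u2 : R -> R, C2_line u u1 u2 /\
    forall t, - u2 t + (r1 + r2) * u1 t - r1 * r2 * u t = f t.
Proof.
move=> cf.
have [|p dp] := first_order_solve r2 (fun t => - f t).
  by move=> t; apply: cvgN; exact: cf.
have cp := is_derive_line_continuous dp.
have [u du] := first_order_solve r1 _ cp.
have cu := is_derive_line_continuous du.
have du1 (t : R) := is_derive_add (is_derive_scale r1 (du t)) (dp t).
exists u, (fun t => r1 * u t + p t),
  (fun t => r1 * (r1 * u t + p t) + (r2 * p t - f t)); split.
  split=> [t|t]; first by split; [exact: du|exact: du1].
  have cM k (g : R -> R) : continuous g -> (k * g s) @[s --> t] --> k * g t.
    by move=> cg; apply: cvgM; [exact: cvg_cst|exact: cg].
  apply: cvgD; last by apply: cvgB; [exact: cM|exact: cf].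
  apply: cvgM; first exact: cvg_cst.
  by apply: cvgD; [exact: cM|exact: cp].
by move=> t; ring.
Qed.

(** A particular solution is corrected by exponentials so that the boundary conditions become
    triangular: a multiple of exp(r1 t) fixes the Robin value at [al], then a multiple of a solution
    [Y] with zero Robin value fixes the value at [be]. *)
Lemma linear_solve (al be sg tau r1 r2 d e : R) (f : R -> R) :
  al < be -> 0 <= sg -> 0 < tau -> r1 < 0 -> 0 < r2 -> continuous f ->
  exists u u1 u2 : R -> R, [/\ C2_line u u1 u2,
    forall t, - u2 t + (r1 + r2) * u1 t - r1 * r2 * u t = f t,
    sg * u1 al - tau * u al = d & u be = e].
Proof.
move=> albe sg0 tau0 r10 r20 cf.
have [w [w1 [w2 [C2w eqw]]]] := linear_particular r1 r2 _ cf.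
(* Normalised to 1 at [al], the exponentials with exponents r1 and r2 have Robin values -A and B.
   Hence the combination with weights B and A, which is [Y], has Robin value 0. *)
pose A := tau - sg * r1; pose B := sg * r2 - tau.
pose k1 := expR (- (r1 * al)); pose k2 := expR (- (r2 * al)).
pose E1 (t : R) := expR (r1 * t); pose E2 (t : R) := expR (r2 * t).
have kE1 : k1 * E1 al = 1 by rewrite -expRD addNr expR0.
have kE2 : k2 * E2 al = 1 by rewrite -expRD addNr expR0.
have A0 : 0 < A by rewrite /A; nra.
have C2Y := C2_line_axpy (B * k1)
  (C2_line_scale (A * k2) (C2_line_expR r2)) (C2_line_expR r1).
set Y := (X in C2_line X _ _) in C2Y.
set Y1 := (X in C2_line _ X _) in C2Y.
set Y2 := (X in C2_line _ _ X) in C2Y.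
have lY : sg * Y1 al - tau * Y al = 0.
  rewrite /Y1 /Y -/(E1 al) -/(E2 al).
  transitivity (sg * (A * r2 * (k2 * E2 al) + B * r1 * (k1 * E1 al)) -
    tau * (A * (k2 * E2 al) + B * (k1 * E1 al))); first by ring.
  by rewrite kE1 kE2 /A /B; ring.
(* Y(be) = A x2 + B x1 with 0 < x1 < 1 < x2. As A > 0 and A + B = sg (r2 - r1) >= 0, this exceeds (A
   + B) x1 >= 0. *)
have Ybe : 0 < Y be.
  rewrite /Y -!mulrA -!expRD.
  have x1 : expR (- (r1 * al) + r1 * be) < 1 by rewrite expR_lt1; nra.
  have x2 : 1 < expR (- (r2 * al) + r2 * be) by rewrite expR_gt1; nra.
  have x0 := expR_gt0 (- (r1 * al) + r1 * be).
  have AB0 : 0 <= A + B by rewrite /A /B; nra.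
  nra.
pose l1 := (sg * r1 - tau) * E1 al.
have l1N0 : l1 != 0.
  rewrite mulf_neq0//; last by rewrite gt_eqF ?expR_gt0.
  by rewrite lt_eqF// -oppr_gt0 opprB.
pose c1 := (d - (sg * w1 al - tau * w al)) / l1.
pose c2 := (e - w be - c1 * E1 be) / Y be.
have C2u := C2_line_axpy c2 (C2_line_axpy c1 C2w (C2_line_expR r1)) C2Y.
do 3 eexists; split; first exact: C2u.
- move=> t; rewrite -eqw /Y /Y1 /Y2; ring.
- transitivity (sg * w1 al - tau * w al + c1 * l1 +
    c2 * (sg * Y1 al - tau * Y al)); first by rewrite /l1 /E1 /Y1 /Y; ring.
  by rewrite lY mulr0 addr0 /c1 divfK// addrC subrK.
- by rewrite /c2 divfK ?gt_eqF// -/(E1 be); move: (E1 be) => x; ring.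
Qed.

End LinearProblem.

Section BoundaryValueProblem.
Context {R : realType}.

(** The constants [dl] and [- dl] are barriers: the operator sends them to c dl and - c dl, and the
    Robin form to - tau dl and tau dl, which are exactly the tolerated errors. *)
Lemma linear_estimate (al be sg tau b c dl : R) (u u1 u2 : R -> R) :
  al < be -> 0 <= sg -> 0 < tau -> 0 < c -> C2_line u u1 u2 ->
  (forall t, al < t < be -> `|- u2 t + b * u1 t + c * u t| <= c * dl) ->
  `|sg * u1 al - tau * u al| <= tau * dl -> `|u be| <= dl ->
  forall t, al <= t <= be -> `|u t| <= dl.
Proof.
move=> albe sg0 tau0 c0 C2u Lu; rewrite !ler_norml => /andP[la la'] /andP[ub ub'].
move=> t tI; rewrite ler_norml; apply/andP; split.
- apply: (comparison_principle _ _ _ _ _ _ _ _ _ _ albe sg0 tau0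
    (C2_line_cst (- dl)) C2u) => //; last by nra.
  move=> s sI us u1s; have := Lu s sI; rewrite -u1s ler_norml => /andP[h _].
  by nra.
- apply: (comparison_principle _ _ _ _ _ _ _ _ _ _ albe sg0 tau0
    C2u (C2_line_cst dl)) => //; last by nra.
  move=> s sI us u1s; have := Lu s sI; rewrite u1s ler_norml => /andP[_ h].
  by nra.
Qed.

(* Only existence of approximate solutions is used: each is compared with the exact
   solution of the linear problem, so no derivative has to converge. *)
Lemma uniform_limit_solution (al be sg tau r1 r2 d : R) (f U : R -> R) :
  al < be -> 0 <= sg -> 0 < tau -> r1 < 0 -> 0 < r2 -> continuous f ->
  (forall dl, 0 < dl -> exists u u1 u2 : R -> R, [/\ C2_line u u1 u2,
    forall t, al < t < be ->
      `|- u2 t + (r1 + r2) * u1 t - r1 * r2 * u t - f t| <= - (r1 * r2) * dl,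
    `|sg * u1 al - tau * u al - d| <= tau * dl &
    forall t, al <= t <= be -> `|u t - U t| <= dl]) ->
  exists v v1 v2 : R -> R, [/\ C2_line v v1 v2,
    forall t, - v2 t + (r1 + r2) * v1 t - r1 * r2 * v t = f t,
    sg * v1 al - tau * v al = d & forall t, al <= t <= be -> v t = U t].
Proof.
move=> albe sg0 tau0 r10 r20 cf approx.
have [v [v1 [v2 [C2v eqv lv vbe]]]] :=
  linear_solve al be sg tau r1 r2 d (U be) f albe sg0 tau0 r10 r20 cf.
exists v, v1, v2; split => // t tI; apply/eqP; rewrite -subr_eq0 -normr_le0.
apply/ler_addgt0Pr => e e0; rewrite add0r.
have [u [u1 [u2 [C2u equ lu uU]]]] := approx _ (divr_gt0 e0 (ltr0Sn R 1)).
have be_in : al <= be <= be by rewrite lexx ltW.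
have c0 : 0 < - (r1 * r2) by rewrite oppr_gt0 nmulr_rlt0.
have vu : `|u t - v t| <= e / 2.
  rewrite -mulN1r.
  apply: (linear_estimate al be sg tau (r1 + r2) _ _ _ _ _ albe sg0 tau0 c0
    (C2_line_axpy (-1) C2u C2v)) => //.
  - move=> s sI; apply: le_trans (equ s sI); rewrite -eqv.
    by rewrite le_eqVlt; apply/orP; left; apply/eqP; congr `|_|; ring.
  - apply: le_trans lu; rewrite -lv.
    by rewrite le_eqVlt; apply/orP; left; apply/eqP; congr `|_|; ring.
  - by rewrite mulN1r vbe uU.
have -> : v t - U t = (u t - U t) - (u t - v t) by ring.
by rewrite (le_trans (ler_normB _ _))// [leRHS](splitr e) lerD// uU.
Qed.

Lemma uniform_cauchy_limit (S : set R) (u : nat -> R -> R) :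
  (forall e, 0 < e -> exists n0, forall n m t, (n0 <= n <= m)%N -> S t ->
    `|u m t - u n t| <= e) ->
  forall e, 0 < e -> exists n0, forall n t, (n0 <= n)%N -> S t ->
    `|u n t - lim (u ^~ t @ \oo)| <= e.
Proof.
move=> cauchy e e0; have [n0 Hn0] := cauchy e e0.
exists n0 => n t n0n St.
have cvgu : cvg (u ^~ t @ \oo).
  apply/cauchy_cvgP/cauchy_exP => e' e'0.
  have [n1 Hn1] := cauchy _ (divr_gt0 e'0 (ltr0Sn R 1)).
  exists (u n1 t); exists n1 => // m /= n1m.
  rewrite /ball/= distrC (le_lt_trans (Hn1 n1 m t _ St)) ?leqnn//.
  by rewrite ltr_pdivrMr// ltr_pMr// ltr1n.
have near_n : \forall m \near \oo, `|u m t - u n t| <= e.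
  by exists n => // m /= nm; apply: Hn0 => //; rewrite n0n.
rewrite ler_distlC; apply/andP; split.
  apply: limr_ge => //; move: near_n; apply: filterS => m.
  by rewrite ler_distl => /andP[].
apply: limr_le => //; move: near_n; apply: filterS => m.
by rewrite ler_distl => /andP[].
Qed.

(** Uniform limits are controlled on [al, be] only, whereas the linear theory asks for a source
    continuous on the whole line. Composing with the projection onto [al, be] supplies the
    extension. *)
Lemma clamp_continuous (al be : R) (U : R -> R) : al <= be ->
  (forall e, 0 < e -> exists2 g : R -> R, continuous g &
    forall t, al <= t <= be -> `|g t - U t| <= e) ->
  continuous (fun t => U (Num.max al (Num.min t be))).
Proof.
move=> albe approx t; set k := fun s : R => Num.max al (Num.min s be).
have kI s : al <= k s <= be.
  by rewrite /k le_max lexx ge_max albe ge_min lexx orbT.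
have ck : continuous k.
  move=> s; apply: (@continuous_max _ _ (fun=> al) (fun s => Num.min s be)).
    exact: cvg_cst.
  apply: (@continuous_min _ _ id (fun=> be)); first exact: cvg_id.
  exact: cvg_cst.
apply/cvgrPdist_le => /= e e0.
have [g cg gU] := approx _ (divr_gt0 e0 (ltr0Sn R 2)).
have cgk : (g \o k) s @[s --> t] --> (g \o k) t.
  by apply: continuous_comp; [exact: ck|exact: cg].
have e3 : 0 < e / 3 by rewrite divr_gt0.
near=> s.
have : `|g (k t) - g (k s)| <= e / 3.
  by near: s; exact: (cvgrPdist_le _ _).1 cgk _ e3.
move: (gU _ (kI t)) (gU _ (kI s)); rewrite !ler_norml.
by move=> /andP[? ?] /andP[? ?] /andP[? ?]; apply/andP; split; lra.
Unshelve. all: by end_near. Qed.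

End BoundaryValueProblem.

(** * The semilinear problem on a bounded interval *)

Section SemilinearProblem.
Context {R : realType}.

Lemma C2_line_continuous {u u1 u2 : R -> R} : C2_line u u1 u2 -> continuous u.
Proof. by move=> [du _]; exact: is_derive_line_continuous (fun t => (du t).1). Qed.

(** Since A >= 0 and 0 <= h <= p M, the constants 0 and M are a lower and an upper solution. They
    trap every iterate in [0, M], the range on which the iteration contracts. *)
Lemma semilinear_bvp (al be sg tau p M : R) (A h : R -> R) :
  al < be -> 0 <= sg -> 0 < tau -> 0 < p -> 0 < M ->
  continuous A -> continuous h ->
  (forall t, al <= t <= be -> 0 <= A t) ->
  (forall t, al <= t <= be -> 0 <= h t <= p * M) ->
  exists u u1 u2 : R -> R, [/\ C2_line u u1 u2,
    forall t, al <= t <= be ->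
      - u2 t + (p - 1) * u1 t + p * u t + A t * u t ^+ 2 = h t,
    sg * u1 al - tau * u al = 0, u be = 0 &
    forall t, al <= t <= be -> 0 <= u t <= M].
Proof.
move=> albe sg0 tau0 p0 M0 cA ch A0 h0.
have [B AB] : exists B, forall t, al <= t <= be -> A t <= B.
  have [c _ cmax] := EVT_max (ltW albe) (continuous_subspaceT cA).
  by exists (A c) => t tI; apply: cmax.
have B0 : 0 <= B.
  by apply: le_trans (AB al _); [apply: A0|]; rewrite lexx ltW.
(* Adding [K u] to both sides makes the right-hand side [K u - A u^2 + h] monotone
   and [K]-Lipschitz on [0, M], while the left-hand side becomes coercive with
   constant [p + K]: the iteration contracts with factor [K / (p + K)]. The shape
   of [K] makes the characteristic roots [-1 - k] and [p + k]. *)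
pose k := 2 * (B * M); pose K := k * (p + 1 + k).
have k0 : 0 <= k by rewrite !mulr_ge0// ltW.
have K0 : 0 <= K by rewrite mulr_ge0//; lra.
have kK : k <= K by rewrite -[leLHS]mulr1 ler_wpM2l//; lra.
(* The range up to 2 M, the source of the factor 2 in [k], is needed for x = v + w in F v - F w = (K
   - A (v + w)) (v - w). The invariance of [0, M] uses x = u. *)
have KA s x : al <= s <= be -> 0 <= x <= 2 * M -> 0 <= K - A s * x <= K.
  move=> sI /andP[x0 xM].
  have As := A0 s sI; have Bs := AB s sI.
  have : A s * x <= B * (2 * M) by rewrite ler_pM.
  have : 0 <= A s * x by rewrite mulr_ge0.
  by move: kK; rewrite /k => *; lra.
pose q := K / (p + K).
have pK0 : 0 < p + K by rewrite ltr_wpDr.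
have q0 : 0 <= q by rewrite divr_ge0// ltW.
have q1 : q < 1 by rewrite ltr_pdivrMr// mul1r ltrDr.
have pKq : (p + K) * q = K by rewrite mulrC divfK ?gt_eqF.
pose F (u : R -> R) t := K * u t - A t * u t ^+ 2 + h t.
have cF u : continuous u -> continuous (F u).
  move=> cu t; apply: cvgD; last exact: ch.
  apply: cvgB; first by apply: cvgM; [exact: cvg_cst|exact: cu].
  by apply: cvgM; [exact: cA|apply: cvgM; exact: cu].
pose step (x y : (R -> R) * (R -> R) * (R -> R)) := continuous x.1.1 ->
  [/\ C2_line y.1.1 y.1.2 y.2,
   forall t, - y.2 t + (p - 1) * y.1.2 t + (p + K) * y.1.1 t = F x.1.1 t,
   sg * y.1.2 al - tau * y.1.1 al = 0 & y.1.1 be = 0].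
have roots : (- 1 - k < 0) /\ (0 < p + k) by split; lra.
have rootsD : - 1 - k + (p + k) = p - 1 by ring.
have rootsM : - ((- 1 - k) * (p + k)) = p + K by rewrite /K; ring.
(* The iteration acts on triples made of a function and its two derivatives. Continuity is a premise
   inside [step] so that [G] is total; a discontinuous input is returned unchanged. *)
have /choice[G GP] : forall x, exists y, step x y.
  move=> x; have [cx|ncx] := pselect (continuous x.1.1); last by exists x.
  have [u [u1 [u2 [C2u equ lu ube]]]] := linear_solve al be sg tau _ _ 0 0 _
    albe sg0 tau0 roots.1 roots.2 (cF _ cx).
  exists (u, u1, u2) => _; split=> //= t; rewrite -(equ t) -rootsD -rootsM.
  by ring.
pose s n := iter n G (fun=> 0, fun=> 0, fun=> 0).
pose u n := (s n).1.1.
have C2s n : C2_line (u n) (s n).1.2 (s n).2.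
  elim: n => [|n IH]; first exact: C2_line_cst.
  by have [] := GP (s n) (C2_line_continuous IH).
have eqs n t : - (s n.+1).2 t + (p - 1) * (s n.+1).1.2 t + (p + K) * u n.+1 t =
    F (u n) t.
  by have [_ ->] := GP (s n) (C2_line_continuous (C2s n)).
have ls n : sg * (s n).1.2 al - tau * u n al = 0.
  case: n => [|n]; first by rewrite /u/= !mulr0 subr0.
  by have [] := GP (s n) (C2_line_continuous (C2s n)).
have sbe n : u n be = 0.
  case: n => [|n] //.
  by have [] := GP (s n) (C2_line_continuous (C2s n)).
have uM n t : al <= t <= be -> 0 <= u n t <= M.
  elim: n t => [|n IH] t tI; first by rewrite /u/= lexx ltW.
  have FM r : al <= r <= be -> 0 <= F (u n) r <= (p + K) * M.
    move=> rI; have /andP[a b] := IH r rI; have /andP[c d] := h0 r rI.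
    have -> : F (u n) r = (K - A r * u n r) * u n r + h r by rewrite /F; ring.
    have /andP[e f] : 0 <= K - A r * u n r <= K.
      by apply: KA => //; apply/andP; split => //; lra.
    have : (K - A r * u n r) * u n r <= K * M by rewrite ler_pM.
    have : 0 <= (K - A r * u n r) * u n r by rewrite mulr_ge0.
    by move=> *; apply/andP; split; lra.
  have FM' r : al < r < be -> 0 <= F (u n) r <= (p + K) * M.
    by move=> /andP[? ?]; apply: FM; rewrite !ltW.
  apply/andP; split.
  - apply: (comparison_principle _ _ _ _ _ _ _ _ _ _ albe sg0 tau0
      (C2_line_cst 0) (C2s n.+1)) => //; last by rewrite sbe.
      move=> r rI ur u1r; have := eqs n r; rewrite -u1r.
      have /andP[a _] := FM' r rI; rewrite mulr0 addr0 => e.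
      suff : (p + K) * u n.+1 r < 0 by lra.
      by rewrite pmulr_rlt0.
    by have := ls n.+1; lra.
  - apply: (comparison_principle _ _ _ _ _ _ _ _ _ _ albe sg0 tau0
      (C2s n.+1) (C2_line_cst M)) => //; last by rewrite sbe ltW.
      move=> r rI ur u1r; have := eqs n r; rewrite u1r.
      have /andP[_ a] := FM' r rI; rewrite mulr0 addr0 => e.
      suff : (p + K) * M < (p + K) * u n.+1 r by lra.
      by rewrite ltr_pM2l.
    have tM : 0 < tau * M by rewrite mulr_gt0.
    by have := ls n.+1; lra.
have FK v w dl t : al <= t <= be -> 0 <= v t <= M -> 0 <= w t <= M ->
    `|v t - w t| <= dl -> `|F v t - F w t| <= K * dl.
  move=> tI /andP[v0 vM] /andP[w0 wM] vw.
  have -> : F v t - F w t = (K - A t * (v t + w t)) * (v t - w t).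
    by rewrite /F; ring.
  have /andP[a b] : 0 <= K - A t * (v t + w t) <= K.
    by apply: KA => //; apply/andP; split; lra.
  by rewrite normrM ler_pM// ger0_norm.
(* The start is the zero function, so the first difference is at most M. Afterwards the source
   changes by at most K times the previous difference, and K = (p + K) q lets the linear estimate
   gain the factor [q]. *)
have contr n t : al <= t <= be -> `|u n.+1 t - u n t| <= M * q ^+ n.
  elim: n t => [|n IH] t tI.
    rewrite expr0 mulr1 [u 0 t]/= subr0.
    by have /andP[a b] := uM 1%N t tI; rewrite ger0_norm.
  rewrite -mulN1r.
  apply: (linear_estimate al be sg tau (p - 1) _ _ _ _ _ albe sg0 tau0 pK0
    (C2_line_axpy (-1) (C2s n.+2) (C2s n.+1))) => //.
  - move=> r /andP[ar rb].
    have rI : al <= r <= be by rewrite !ltW.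
    have -> : (p + K) * (M * q ^+ n.+1) = K * (M * q ^+ n).
      by rewrite -[in RHS]pKq exprS; ring.
    apply: le_trans (FK (u n.+1) (u n) _ r rI (uM _ _ rI) (uM _ _ rI) (IH r rI)).
    rewrite -!eqs le_eqVlt; apply/orP; left; apply/eqP; congr `|_|; ring.
  - have -> : sg * ((s n.+2).1.2 al + -1 * (s n.+1).1.2 al) -
      tau * (u n.+2 al + -1 * u n.+1 al) = (sg * (s n.+2).1.2 al - tau * u n.+2 al)
      - (sg * (s n.+1).1.2 al - tau * u n.+1 al) by ring.
    by rewrite !ls subr0 normr0 !mulr_ge0// ?exprn_ge0// ltW.
  - by rewrite !sbe mulr0 addr0 normr0 mulr_ge0// ?exprn_ge0// ltW.
pose C := M / (1 - q).
have C0 : 0 < C by rewrite divr_gt0// subr_gt0.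
have tele n m t : al <= t <= be ->
    `|u (n + m)%N t - u n t| <= C * (q ^+ n - q ^+ (n + m)).
  move=> tI; elim: m => [|m IH]; first by rewrite addn0 !subrr normr0 mulr0.
  rewrite addnS; have := lerD (contr (n + m)%N t tI) IH.
  have -> : M * q ^+ (n + m) = C * (q ^+ (n + m) - q ^+ (n + m).+1).
    have CM : C * (1 - q) = M by rewrite /C divfK// subr_eq0 gt_eqF.
    by rewrite -[in LHS]CM exprS; ring.
  move=> H; have := le_trans (ler_normD _ _) H.
  have -> : u (n + m).+1 t - u (n + m)%N t + (u (n + m)%N t - u n t) =
    u (n + m).+1 t - u n t by ring.
  by move=> /le_trans; apply; rewrite le_eqVlt; apply/orP; left; apply/eqP; ring.
have small e : 0 < e -> exists n0, forall n, (n0 <= n)%N -> C * q ^+ n <= e.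
  move=> e0.
  have cq : q ^+ n @[n --> \oo] --> (0 : R) by apply: cvg_expr; rewrite ger0_norm.
  have [n0 _ Hn0] := cvgr_le _ cq _ (divr_gt0 e0 C0).
  by exists n0 => n /Hn0/=; rewrite ler_pdivlMr// mulrC.
have cauchy e : 0 < e -> exists n0, forall n m t, (n0 <= n <= m)%N ->
    [set t | al <= t <= be] t -> `|u m t - u n t| <= e.
  move=> /small[n0 Hn0]; exists n0 => n m t /andP[n0n nm] tI.
  rewrite -(subnKC nm) (le_trans (tele n _ t tI))// (le_trans _ (Hn0 n n0n))//.
  by rewrite ler_pM2l// gerBl exprn_ge0.
pose U t := lim (u ^~ t @ \oo).
have lim_u e : 0 < e -> exists n0, forall n t, (n0 <= n)%N -> al <= t <= be ->
    `|u n t - U t| <= e.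
  exact: uniform_cauchy_limit cauchy e.
have UM t : al <= t <= be -> 0 <= U t <= M.
  move=> tI; apply/andP; split; apply/ler_addgt0Pr => e /lim_u[n Hn];
    have := Hn n t (leqnn _) tI; have /andP[a b] := uM n t tI;
    by rewrite ler_norml => /andP[? ?]; lra.
pose Uc t := U (Num.max al (Num.min t be)).
have UcE t : al <= t <= be -> Uc t = U t.
  by move=> /andP[a b]; rewrite /Uc min_l// max_r.
have cUc : continuous Uc.
  apply: clamp_continuous; first exact: ltW.
  move=> e /lim_u[n Hn]; exists (u n); first exact: C2_line_continuous (C2s n).
  by move=> t; apply: Hn.
(* The iterate of index n + 1 solves the linear problem with source F (u n), which differs from F Uc
   on the interval by at most K dl <= (p + K) dl; so the iterates are approximate solutions for the
   limiting source. *)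
have [|v [v1 [v2 [C2v eqv lv vU]]]] := uniform_limit_solution al be sg tau _ _ 0
    (F Uc) U albe sg0 tau0 roots.1 roots.2 (cF _ cUc).
  move=> dl dl0; have [n Hn] := lim_u dl dl0; exists (u n.+1), (s n.+1).1.2, (s n.+1).2; split => //.
  - move=> t /andP[at_ tb]; have tI : al <= t <= be by rewrite !ltW.
    have -> : - (s n.+1).2 t + (- 1 - k + (p + k)) * (s n.+1).1.2 t -
      (- 1 - k) * (p + k) * u n.+1 t = F (u n) t.
      by rewrite -(eqs n t) -rootsD -rootsM; ring.
    rewrite rootsM.
    apply: (@le_trans _ _ (K * dl)); last by rewrite ler_pM2r// lerDr ltW.
    by apply: FK => //; rewrite ?uM// UcE// ?UM// Hn.
  - by rewrite ls subrr normr0 mulr_ge0// ltW.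
  - by move=> t tI; apply: Hn => //; exact: leqW.
exists v, v1, v2; split => //.
- move=> t tI; have := eqv t; rewrite /F UcE// -vU// rootsD => e.
  have -> : h t = (K * v t - A t * v t ^+ 2 + h t) - K * v t + A t * v t ^+ 2.
    by ring.
  by rewrite -e -[K](addKr p) -rootsM; ring.
- have be_in : al <= be <= be by rewrite lexx ltW.
  rewrite vU//; apply/eqP; rewrite -normr_le0; apply/ler_addgt0Pr => e /lim_u[n Hn].
  by have := Hn n be (leqnn _) be_in; rewrite sbe sub0r normrN add0r.
- by move=> t tI; rewrite vU// UM.
Qed.

End SemilinearProblem.

(** * Bounded intervals exhausting an unbounded one *)

Section Exhaustion.
Context {R : realType}.

Definition semilinear_on (p : R) (A h : R -> R) (al be : R) (u u1 u2 : R -> R) :=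
  C2_line u u1 u2 /\ forall t, al <= t <= be ->
    - u2 t + (p - 1) * u1 t + p * u t + A t * u t ^+ 2 = h t.

Lemma semilinear_onS {p A h al be al' be' u u1 u2} : al <= al' -> be' <= be ->
  semilinear_on p A h al be u u1 u2 -> semilinear_on p A h al' be' u u1 u2.
Proof.
move=> aa bb [C2u eq]; split => // t /andP[at_ tb]; apply: eq.
by rewrite (le_trans aa)// (le_trans tb).
Qed.

(** A supersolution of the linear part is enough, because A u^2 >= 0 may be dropped from the
    equation for [u]. The degenerate case al = be is kept since barriers start at a fixed point that
    may coincide with the end of the interval. *)
Lemma supersolution_comparison (p : R) (A h : R -> R) (al be : R)
    (u u1 u2 v v1 v2 : R -> R) :
  0 < p -> al <= be -> (forall t, 0 <= A t) ->
  semilinear_on p A h al be u u1 u2 -> C2_line v v1 v2 ->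
  (forall t, al <= t <= be -> h t <= - v2 t + (p - 1) * v1 t + p * v t) ->
  u al <= v al -> u be <= v be ->
  forall t, al <= t <= be -> u t <= v t.
Proof.
move=> p0; rewrite le_eqVlt => /predU1P[<- _ _ _ _ uv _ t|albe].
  by rewrite -eq_le => /eqP <-.
move=> A0 [C2u equ] C2v Lv ual ube.
apply: (comparison_principle _ _ 0 1 _ _ _ _ _ _ albe _ _ C2u C2v) => //.
  move=> t /andP[at_ tb] vu uv1; have tI : al <= t <= be by rewrite !ltW.
  have := Lv t tI; rewrite -(equ t tI) -uv1.
  have : 0 <= A t * u t ^+ 2 by rewrite mulr_ge0// sqr_ge0.
  have : p * v t < p * u t by rewrite ltr_pM2l.
  lra.
by rewrite mul0r mul1r subr_le0.
Qed.

(** A nonnegative solution raised by [dl] is an upper barrier for the other: where it is exceeded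
    and the slopes agree, monotonicity of p x + A x^2 on x >= 0 orders the second derivatives. The
    raise changes the Robin form by tau dl, whence the scaling of the boundary error. *)
Lemma solutions_close (p : R) (A h : R -> R) (al be sg tau dl : R)
    (u u1 u2 v v1 v2 : R -> R) :
  0 < p -> al < be -> 0 <= sg -> 0 < tau -> (forall t, 0 <= A t) ->
  semilinear_on p A h al be u u1 u2 -> semilinear_on p A h al be v v1 v2 ->
  (forall t, al <= t <= be -> 0 <= u t) ->
  (forall t, al <= t <= be -> 0 <= v t) ->
  `|(sg * u1 al - tau * u al) - (sg * v1 al - tau * v al)| <= tau * dl ->
  `|u be - v be| <= dl ->
  forall t, al <= t <= be -> `|u t - v t| <= dl.
Proof.
move=> p0 albe sg0 tau0 A0.
have half (w w1 w2 z z1 z2 : R -> R) :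
    semilinear_on p A h al be w w1 w2 -> semilinear_on p A h al be z z1 z2 ->
    (forall t, al <= t <= be -> 0 <= w t) ->
    (forall t, al <= t <= be -> 0 <= z t) -> 0 <= dl ->
    - (tau * dl) <= (sg * w1 al - tau * w al) - (sg * z1 al - tau * z al) ->
    w be - z be <= dl -> forall t, al <= t <= be -> w t - z t <= dl.
  move=> [C2w eqw] [C2z eqz] w0 z0 dl0 lwz wzbe t tI.
  suff : w t <= dl + 1 * z t by rewrite mul1r lerBlDr.
  apply: (comparison_principle _ _ _ _ _ _ _ _ _ _ albe sg0 tau0 C2w
    (C2_line_axpy 1 (C2_line_cst dl) C2z)) => //; last 2 first.
  - lra.
  - by rewrite mul1r -lerBlDr.
  move=> s /andP[as_ sb]; rewrite !mul1r !add0r => zw wz1.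
  have sI : al <= s <= be by rewrite !ltW.
  have := eqw s sI; rewrite -(eqz s sI) wz1.
  have {}zw : z s < w s by lra.
  have : A s * z s ^+ 2 <= A s * w s ^+ 2.
    by rewrite ler_wpM2l// ler_pXn2r ?nnegrE ?w0 ?z0// ltW.
  have : p * z s < p * w s by rewrite ltr_pM2l.
  lra.
move=> Su Sv u0 v0 + uvbe t tI.
have dl0 : 0 <= dl by exact: le_trans uvbe.
rewrite ler_norml => /andP[l1 l2].
move: uvbe; rewrite !ler_norml => /andP[b1 b2]; apply/andP; split.
  by rewrite lerNl opprB; apply: (half _ _ _ _ _ _ Sv Su) => //; lra.
by apply: (half _ _ _ _ _ _ Su Sv) => //; lra.
Qed.

(** From 1 + k x <= exp(k x). The explicit threshold depends on no particular solution, which is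
    what makes the decay uniform along the exhaustion. *)
Lemma expRN_small (k e M x : R) : 0 < k -> 0 < e -> M / (k * e) <= x ->
  M * expR (- (k * x)) <= e.
Proof.
move=> k0 e0; rewrite ler_pdivrMr ?mulr_gt0// => Mx.
rewrite expRN ler_pdivrMr ?expR_gt0//.
have := expR_ge1Dx (k * x); have := expR_gt0 (k * x); nra.
Qed.

(* [e + M exp(T - t)] is a supersolution because [exp(-t)] solves the homogeneous
   linear equation; on the left [exp(p t)] plays this role. *)
Lemma right_barrier (p : R) (A h : R -> R) (T be e M : R) (u u1 u2 : R -> R) :
  0 < p -> (forall t, 0 <= A t) -> semilinear_on p A h T be u u1 u2 ->
  0 <= e -> 0 <= M -> u T <= M -> u be = 0 ->
  (forall t, T <= t -> h t <= p * e) ->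
  forall t, T <= t <= be -> u t <= e + M * expR (- (1 * (t - T))).
Proof.
move=> p0 A0 Su e0 M0 uT ube he t tI.
have Tbe : T <= be by case/andP: tI; exact: le_trans.
have -> : M * expR (- (1 * (t - T))) = (M * expR T) * expR (-1 * t).
  by rewrite -mulrA -expRD; congr (_ * expR _); ring.
have ME0 : 0 <= M * expR T by rewrite mulr_ge0// expR_ge0.
apply: (supersolution_comparison _ _ _ _ _ _ _ _ _ _ _ p0 Tbe A0 Su
  (C2_line_axpy (M * expR T) (C2_line_cst e) (C2_line_expR (-1)))) => //.
- by move=> s /andP[Ts _]; have := he s Ts; lra.
- by rewrite -mulrA -expRD mulN1r subrr expR0 mulr1; lra.
- by rewrite ube addr_ge0// mulr_ge0// expR_ge0.
Qed.

Lemma left_barrier (p : R) (A h : R -> R) (T al e M : R) (u u1 u2 : R -> R) :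
  0 < p -> (forall t, 0 <= A t) -> semilinear_on p A h al T u u1 u2 ->
  0 <= e -> 0 <= M -> u T <= M -> u al = 0 ->
  (forall t, t <= T -> h t <= p * e) ->
  forall t, al <= t <= T -> u t <= e + M * expR (- (p * (T - t))).
Proof.
move=> p0 A0 Su e0 M0 uT ual he t tI.
have Tal : al <= T by case/andP: tI; exact: le_trans.
have -> : M * expR (- (p * (T - t))) = (M * expR (- (p * T))) * expR (p * t).
  by rewrite -mulrA -expRD; congr (_ * expR _); ring.
have ME0 : 0 <= M * expR (- (p * T)) by rewrite mulr_ge0// expR_ge0.
apply: (supersolution_comparison _ _ _ _ _ _ _ _ _ _ _ p0 Tal A0 Su
  (C2_line_axpy (M * expR (- (p * T))) (C2_line_cst e) (C2_line_expR p))) => //.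
- by move=> s /andP[_ sT]; have := he s sT; lra.
- by rewrite ual addr_ge0// mulr_ge0// expR_ge0.
- by rewrite -mulrA -expRD addNr expR0 mulr1; lra.
Qed.

Section Limit.
Context (p M sg tau : R) (A h : R -> R) (al be : nat -> R).
Context (u u1 u2 : nat -> R -> R).
Context (p0 : 0 < p) (M0 : 0 < M) (sg0 : 0 <= sg) (tau0 : 0 < tau).
Context (A0 : forall t, 0 <= A t) (cA : continuous A) (ch : continuous h).
Context (albe : forall n, al n < be n).
Context (al_dec : forall n m, (n <= m)%N -> al m <= al n).
Context (be_inc : forall n m, (n <= m)%N -> be n <= be m).
Context (be_unbounded : forall x, exists n, x <= be n).
Context (Su : forall n, semilinear_on p A h (al n) (be n) (u n) (u1 n) (u2 n)).
Context (ual : forall n, sg * u1 n (al n) - tau * u n (al n) = 0).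
Context (ube : forall n, u n (be n) = 0).
Context (uM : forall n t, al n <= t <= be n -> 0 <= u n t <= M).
Context (h_small : forall e : R, 0 < e -> exists T, forall t, T <= t -> h t <= e).
(** Common form of the two kinds of left end. On the half-line [al] is constant and the Robin form
    vanishes; on the line sg = 0 and tau = 1, and the condition expresses uniform smallness of the
    solutions near -oo. *)
Context (left_small : forall e : R, 0 < e -> exists n0, forall n m,
  (n0 <= n <= m)%N -> `|sg * u1 m (al n) - tau * u m (al n)| <= tau * e).

(** At [T1] only the common bound M is used, so the barrier started there is the same for all [n].
    Taking T1 >= al 0 keeps [T1] right of every left end. *)
Lemma right_decay (e : R) : 0 < e ->
  exists T, al 0 <= T /\ forall n t, T <= t <= be n -> u n t <= e.
Proof.
move=> e0; have e20 : 0 < e / 2 by rewrite divr_gt0.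
have [T HT] := h_small _ (mulr_gt0 p0 e20).
pose T1 := Num.max T (al 0).
have [TT1 aT1] : T <= T1 /\ al 0 <= T1 by rewrite !le_max !lexx orbT.
have x0 : 0 <= M / (1 * (e / 2)) by rewrite divr_ge0 ?mul1r// ltW.
exists (T1 + M / (1 * (e / 2))); split; first by rewrite ler_wpDr.
move=> n t /andP[Tt tb].
have T1t : T1 <= t by lra.
have T1n : al n <= T1 by rewrite (le_trans _ aT1)// al_dec.
have /andP[_ uT1] : 0 <= u n T1 <= M by rewrite uM// T1n (le_trans T1t).
rewrite [leRHS](splitr e).
apply: (le_trans (right_barrier _ _ _ T1 (be n) (e / 2) M _ _ _ p0 A0
  (semilinear_onS T1n (lexx _) (Su n)) (ltW e20) (ltW M0) uT1 (ube n) _ _ _)).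
- by move=> s T1s; apply: HT; exact: le_trans T1s.
- by rewrite T1t.
- by rewrite lerD2l expRN_small// lerBrDl.
Qed.

(** On [al n, be n] both functions solve the same equation and differ only in boundary data: at
    [be n] by the value of [u m], small by uniform decay, and at [al n] by the Robin form controlled
    by [left_small]. *)
Lemma exhaustion_cauchy k (e : R) : 0 < e -> exists n0, forall n m t,
  (n0 <= n <= m)%N -> [set t | al k <= t <= be k] t -> `|u m t - u n t| <= e.
Proof.
move=> e0; have [T [aT HT]] := right_decay _ e0.
have [n1 Hn1] := left_small _ e0; have [n2 Hn2] := be_unbounded T.
exists (maxn k (maxn n1 n2)) => n m t /andP[]; rewrite !geq_max.
move=> /and3P[kn n1n n2n] nm /andP[akt tbk].
have inI r j : al n <= r <= be n -> (n <= j)%N -> 0 <= u j r <= M.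
  move=> /andP[a b] nj; apply: uM.
  by rewrite (le_trans (al_dec _ _ nj))// (le_trans b)// be_inc.
have TN : T <= be n by rewrite (le_trans Hn2)// be_inc.
apply: (solutions_close _ _ _ _ _ _ _ _ _ _ _ _ _ _ p0 (albe n) sg0 tau0 A0
  (semilinear_onS (al_dec _ _ nm) (be_inc _ _ nm) (Su m)) (Su n)).
- by move=> r /inI/(_ nm)/andP[].
- by move=> r /inI/(_ (leqnn n))/andP[].
- by rewrite ual subr0 Hn1// n1n.
- rewrite ube subr0.
  have be_in : al n <= be n <= be n by rewrite lexx ltW.
  have /andP[a _] := inI (be n) m be_in nm.
  by rewrite ger0_norm// HT// TN be_inc.
- by rewrite (le_trans (al_dec _ _ kn))// (le_trans tbk)// be_inc.
Qed.

Let U t := lim (u ^~ t @ \oo).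

Lemma exhaustion_uniform k (e : R) : 0 < e -> exists n0, forall n t, (n0 <= n)%N ->
  al k <= t <= be k -> `|u n t - U t| <= e.
Proof. exact: uniform_cauchy_limit (exhaustion_cauchy k) e. Qed.

Lemma exhaustion_bounds k t : al k <= t <= be k -> 0 <= U t <= M.
Proof.
move=> tI; have /andP[at_ tb] := tI.
have approx (e : R) : 0 < e -> exists2 x, 0 <= x <= M & `|x - U t| <= e.
  move=> /(exhaustion_uniform k)[n Hn]; exists (u (maxn n k) t).
    by rewrite uM// (le_trans (al_dec _ _ (leq_maxr _ _)))//
      (le_trans tb)// be_inc// leq_maxr.
  by rewrite Hn// leq_maxl.
apply/andP; split; apply/ler_addgt0Pr => e /approx[x /andP[? ?]];
  by rewrite ler_norml => /andP[? ?]; lra.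
Qed.

Lemma exhaustion_decay : U t @[t --> +oo] --> 0.
Proof.
apply/cvgrPdist_le => /= e e0.
have [T [aT HT]] := right_decay _ (divr_gt0 e0 (ltr0Sn R 1)).
exists T; split; first exact: num_real.
move=> t Tt; rewrite sub0r normrN.
have [k tk] := be_unbounded t.
have tI : al k <= t <= be k.
  by rewrite tk andbT (le_trans _ (ltW Tt))// (le_trans _ aT)// al_dec.
have [n Hn] := exhaustion_uniform k _ (divr_gt0 e0 (ltr0Sn R 1)).
have := Hn (maxn n k) t (leq_maxl _ _) tI.
have : u (maxn n k) t <= e / 2.
  by rewrite HT// (ltW Tt)/= (le_trans tk)// be_inc// leq_maxr.
have /andP[U0 _] := exhaustion_bounds _ _ tI; rewrite (ger0_norm U0).
by rewrite ler_norml => ? /andP[? ?]; lra.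
Qed.

(** With A U^2 moved into the source, the limit solves a linear problem with roots -1 and p. The
    condition at [a] is left free: the original Robin condition at a genuine end, or a Dirichlet
    value read off from [U] at an interior point. *)
Lemma exhaustion_local k a b sg' tau' d : al k <= a -> b <= be k -> a < b ->
  0 <= sg' -> 0 < tau' ->
  (forall e : R, 0 < e -> exists n0, forall n, (n0 <= n)%N ->
    `|sg' * u1 n a - tau' * u n a - d| <= e) ->
  exists v v1 v2, [/\ semilinear_on p A h a b v v1 v2,
    sg' * v1 a - tau' * v a = d & forall t, a <= t <= b -> v t = U t].
Proof.
move=> aka bbk ab sg'0 tau'0 ld.
have kI t : a <= t <= b -> al k <= t <= be k.
  by move=> /andP[? ?]; rewrite (le_trans aka)// (le_trans _ bbk).
have [B AB] : exists B, forall t, a <= t <= b -> A t <= B.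
  have [c _ cmax] := EVT_max (ltW ab) (continuous_subspaceT cA).
  by exists (A c) => t tI; apply: cmax.
have B0 : 0 <= B.
  by apply: le_trans (A0 a) (AB a _); rewrite lexx ltW.
pose Uc t := U (Num.max a (Num.min t b)).
have UcE t : a <= t <= b -> Uc t = U t.
  by move=> /andP[? ?]; rewrite /Uc min_l// max_r.
have cUc : continuous Uc.
  apply: clamp_continuous; first exact: ltW.
  move=> e /(exhaustion_uniform k)[n Hn]; exists (u n).
    exact: C2_line_continuous (Su n).1.
  by move=> t /kI; apply: Hn.
pose f t := h t - A t * Uc t ^+ 2.
have cf : continuous f.
  move=> t; apply: cvgB; first exact: ch.
  by apply: cvgM; [exact: cA|apply: cvgM; exact: cUc].
have N10 : -1 < 0 :> R by rewrite oppr_lt0.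
have [|v [v1 [v2 [C2v eqv lv vU]]]] := uniform_limit_solution a b sg' tau' (-1) p
    d f U ab sg'0 tau'0 N10 p0 cf.
  (* The residual of [u n] is A (U + u n) (U - u n), at most 2 M B e, and must not exceed p dl. The
     summand 1 keeps the denominator positive when B = 0. *)
  move=> dl dl0; pose e := Num.min dl (p * dl / (2 * M * B + 1)).
  have MB0 : 0 <= 2 * M * B by rewrite !mulr_ge0// ltW.
  have MB1 : 0 < 2 * M * B + 1 by rewrite ltr_wpDl.
  have e0 : 0 < e by rewrite lt_min dl0 divr_gt0// mulr_gt0.
  have [n1 Hn1] := exhaustion_uniform k _ e0.
  have [n2 Hn2] := ld _ (mulr_gt0 tau'0 dl0).
  pose n := maxn k (maxn n1 n2).
  have [kn n1n n2n] : [/\ k <= n, n1 <= n & n2 <= n]%N.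
    by rewrite /n !leq_max !leqnn !orbT.
  exists (u n), (u1 n), (u2 n); split; first exact: (Su n).1.
  - move=> t /andP[at_ tb]; have tI : a <= t <= b by rewrite !ltW.
    have tn : al n <= t <= be n.
      have /andP[? ?] := kI _ tI.
      by rewrite (le_trans (al_dec _ _ kn))// (le_trans _ (be_inc _ _ kn)).
    have -> : - u2 n t + (-1 + p) * u1 n t - -1 * p * u n t - f t =
        A t * (U t + u n t) * (U t - u n t).
      by rewrite /f UcE// -((Su n).2 t tn); ring.
    rewrite !normrM mulN1r opprK (ger0_norm (A0 t)).
    have /andP[? ?] := uM _ _ tn; have /andP[? ?] := exhaustion_bounds _ _ (kI _ tI).
    rewrite ger0_norm ?addr_ge0//.
    have Ue : `|U t - u n t| <= p * dl / (2 * M * B + 1).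
      by rewrite distrC (le_trans (Hn1 n t n1n (kI _ tI)))// ge_min lexx orbT.
    apply: (@le_trans _ _ (2 * M * B * (p * dl / (2 * M * B + 1)))).
      apply: ler_pM => //; first by rewrite mulr_ge0// addr_ge0.
      rewrite mulrC ler_pM ?addr_ge0 ?AB//; lra.
    rewrite mulrA ler_pdivrMr// mulrC ler_wpM2l ?lerDl//.
    by rewrite mulr_ge0// ltW.
  - exact: Hn2.
  - move=> t /kI tI; apply: le_trans (Hn1 n t n1n tI) _.
    by rewrite ge_min lexx.
exists v, v1, v2; split => //; split=> // t tI.
have := eqv t; rewrite /f UcE// -vU// => e.
by rewrite -[h t](subrK (A t * v t ^+ 2)) -e; ring.
Qed.

End Limit.
End Exhaustion.

(** * Unbounded intervals *)

Section Gluing.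
Context {R : realType}.

Lemma C2_line_near {u v v1 v2 : R -> R} {t : R} : C2_line v v1 v2 ->
  (\forall s \near t, v s = u s) ->
  [/\ is_derive t 1 u (v1 t), is_derive t 1 (derive1 u) (v2 t) &
    \forall s \near t, v2 s = (derive1 (derive1 u)) s].
Proof.
move=> [dv _] vu.
have vu1 : \forall s \near t, v1 s = (derive1 u) s.
  move/near_join : vu; apply: filterS => s vu.
  have du := near_eq_is_derive vu (dv s).1.
  by rewrite derive1E (@derive_val _ _ _ _ _ _ _ du).
have vu2 : \forall s \near t, v2 s = (derive1 (derive1 u)) s.
  move/near_join : vu1; apply: filterS => s vu1.
  have du1 := near_eq_is_derive vu1 (dv s).2.
  by rewrite derive1E (@derive_val _ _ _ _ _ _ _ du1).
split => //; first exact: near_eq_is_derive vu (dv t).1.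
exact: near_eq_is_derive vu1 (dv t).2.
Qed.

(** Being C^2 is local, and [derive1] provides one global choice of derivatives with which those of
    every local piece agree. *)
Lemma C2_line_glue (u : R -> R) :
  (forall t : R, exists v v1 v2, C2_line v v1 v2 /\ \forall s \near t, v s = u s) ->
  C2_line u (derive1 u) (derive1 (derive1 u)).
Proof.
move=> loc; split=> t; have [v [v1 [v2 [C2v vu]]]] := loc t.
  have [du du1 _] := C2_line_near C2v vu.
  rewrite !derive1E; split.
    by rewrite (@derive_val _ _ _ _ _ _ _ du).
  rewrite (_ : 'D_1 _ t = v2 t)//.
  by rewrite (@derive_val _ _ _ _ _ _ _ du1).
have [_ _ v2u] := C2_line_near C2v vu.
have u2t : (derive1 (derive1 u)) t = v2 t by rewrite -(nbhs_singleton v2u).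
by rewrite /continuous_at u2t; apply: cvg_trans (C2v.2 t); exact: near_eq_cvg.
Qed.

End Gluing.

Section UnboundedIntervals.
Context {R : realType}.

Lemma exhausting_solutions (al be : nat -> R) (sg tau p M : R) (A h : R -> R) :
  (forall n, al n < be n) -> 0 <= sg -> 0 < tau -> 0 < p -> 0 < M ->
  continuous A -> continuous h -> (forall t, 0 <= A t) ->
  (forall t, 0 <= h t <= p * M) ->
  exists u u1 u2 : nat -> R -> R, [/\
    forall n, semilinear_on p A h (al n) (be n) (u n) (u1 n) (u2 n),
    forall n, sg * u1 n (al n) - tau * u n (al n) = 0,
    forall n, u n (be n) = 0 &
    forall n t, al n <= t <= be n -> 0 <= u n t <= M].
Proof.
move=> albe sg0 tau0 p0 M0 cA ch A0 h0.
have /choice[s Hs] : forall n, exists s : (R -> R) * (R -> R) * (R -> R),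
    [/\ semilinear_on p A h (al n) (be n) s.1.1 s.1.2 s.2,
      sg * s.1.2 (al n) - tau * s.1.1 (al n) = 0, s.1.1 (be n) = 0 &
      forall t, al n <= t <= be n -> 0 <= s.1.1 t <= M].
  move=> n; have [u [u1 [u2 [C2u equ lu ube uM]]]] := semilinear_bvp (al n) (be n)
    sg tau p M A h (albe n) sg0 tau0 p0 M0 cA ch (fun t _ => A0 t) (fun t _ => h0 t).
  by exists (u, u1, u2); split.
exists (fun n => (s n).1.1), (fun n => (s n).1.2), (fun n => (s n).2).
by split=> n; have [] := Hs n.
Qed.

Lemma natSr_ge (n m : nat) : (n <= m)%N -> n.+1%:R <= m.+1%:R :> R.
Proof. by rewrite ler_nat. Qed.

Lemma natSr_unbounded (x : R) : exists n : nat, x <= n.+1%:R.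
Proof.
exists (Num.truncn `|x|); rewrite (le_trans (ler_norm x))//.
by rewrite ltW// truncnS_gt.
Qed.

Lemma eventually_le_pinfty {h : R -> R} : h t @[t --> +oo] --> 0 ->
  forall e : R, 0 < e -> exists T : R, forall t, T <= t -> h t <= e.
Proof.
move=> h0 e e0; have [T [_ HT]] := cvgr_le _ h0 _ e0.
by exists (T + 1) => t Tt; apply: HT; rewrite (lt_le_trans _ Tt)// ltrDl.
Qed.

Lemma eventually_le_ninfty {h : R -> R} : h t @[t --> -oo] --> 0 ->
  forall e : R, 0 < e -> exists T : R, forall t, t <= T -> h t <= e.
Proof.
move=> h0 e e0; have [T [_ HT]] := cvgr_le _ h0 _ e0.
by exists (T - 1) => t Tt; apply: HT; rewrite (le_lt_trans Tt)// ltrBlDr ltrDl.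
Qed.

Lemma halfline_solution (sg tau p M : R) (A h : R -> R) :
  0 <= sg -> 0 < tau -> 0 < p -> 0 < M ->
  continuous A -> continuous h -> (forall t, 0 <= A t) ->
  (forall t, 0 <= h t <= p * M) -> h t @[t --> +oo] --> 0 ->
  exists u u1 u2 : R -> R, [/\ C2_line u u1 u2,
    forall t, 0 <= t ->
      - u2 t + (p - 1) * u1 t + p * u t + A t * u t ^+ 2 = h t,
    sg * u1 0 - tau * u 0 = 0 & u t @[t --> +oo] --> 0].
Proof.
move=> sg0 tau0 p0 M0 cA ch A0 h0 /eventually_le_pinfty hsmall.
pose al (_ : nat) : R := 0; pose be (n : nat) : R := n.+1%:R.
have albe n : al n < be n by rewrite ltr0n.
have [u [u1 [u2 [Su ual ube uM]]]] :=
  exhausting_solutions al be sg tau p M A h albe sg0 tau0 p0 M0 cA ch A0 h0.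
have left_small (e : R) : 0 < e -> exists n0, forall n m, (n0 <= n <= m)%N ->
    `|sg * u1 m (al n) - tau * u m (al n)| <= tau * e.
  move=> e0; exists 0%N => n m _.
  by rewrite (ual m) normr0 mulr_ge0// ltW.
pose U t := lim (u ^~ t @ \oo).
have local b : 0 < b -> exists v v1 v2, [/\ semilinear_on p A h 0 b v v1 v2,
    sg * v1 0 - tau * v 0 = 0 & forall t, 0 <= t <= b -> v t = U t].
  move=> b0; have [k bk] := natSr_unbounded b.
  apply: (exhaustion_local p M sg tau A h al be u u1 u2 p0 M0 sg0 tau0 A0 cA ch
    albe (fun _ _ _ => lexx _) natSr_ge natSr_unbounded Su ual ube uM hsmall
    left_small k 0 b sg tau 0) => // e e0.
  by exists 0%N => n _; rewrite (ual n) subr0 normr0 ltW.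
have [v [v1 [v2 [[C2v eqv] lv vU]]]] := local 1 ltr01.
(* [U] is meaningless for negative [t]; there [v] provides a C^2 extension. *)
pose w t := if t <= 0 then v t else U t.
(* On [0, 1] the functions [v] and [U] coincide, so [w] equals [v] on both sides of 0 and no
   matching of derivatives at 0 is left to check. *)
have wv (t : R) : t < 1 -> \forall s \near t, v s = w s.
  move=> t1; near=> s; rewrite /w; case: (leP s 0) => // s0.
  rewrite vU// (ltW s0)/= ltW//; near: s; exact: lt_nbhsl.
have wV (t : R) : 0 < t -> exists y y1 y2, semilinear_on p A h 0 (t + 1) y y1 y2 /\
    \forall s \near t, y s = w s.
  move=> t0; have [|y [y1 [y2 [Sy _ yU]]]] := local (t + 1); first by rewrite addr_gt0.
  exists y, y1, y2; split=> //; near=> s.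
  have s0 : 0 < s by near: s; exact: lt_nbhsr.
  rewrite /w leNgt s0/= yU// (ltW s0)/= ltW//.
  by near: s; apply: lt_nbhsl; rewrite ltrDl.
exists w, (derive1 w), (derive1 (derive1 w)); split.
- apply: C2_line_glue => t; have [t0|t0] := leP t 0.
    by exists v, v1, v2; split=> //; apply: wv; rewrite (le_lt_trans t0).
  by have [y [y1 [y2 [[C2y _] yw]]]] := wV t t0; exists y, y1, y2.
- move=> t; rewrite le_eqVlt => /predU1P[<-|t0].
    have vw := wv 0 ltr01; have [dw dw1 _] := C2_line_near C2v vw.
    rewrite !derive1E (@derive_val _ _ _ _ _ _ _ dw) (@derive_val _ _ _ _ _ _ _ dw1).
    by rewrite -(nbhs_singleton vw) eqv// lexx ler01.
  have [y [y1 [y2 [[C2y eqy] yw]]]] := wV t t0.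
  have [dw dw1 _] := C2_line_near C2y yw.
  rewrite !derive1E (@derive_val _ _ _ _ _ _ _ dw) (@derive_val _ _ _ _ _ _ _ dw1).
  by rewrite -(nbhs_singleton yw) eqy// ltW//= lerDl.
- have vw := wv 0 ltr01; have [dw _ _] := C2_line_near C2v vw.
  by rewrite derive1E (@derive_val _ _ _ _ _ _ _ dw) -(nbhs_singleton vw).
- have := exhaustion_decay p M sg tau A h al be u u1 u2 p0 M0 sg0 tau0 A0
    albe (fun _ _ _ => lexx _) natSr_ge natSr_unbounded Su ual ube uM hsmall
    left_small.
  apply: cvg_trans; apply: near_eq_cvg; exists 0; split; first exact: num_real.
  by move=> t t0; rewrite /w leNgt t0.
Unshelve. all: by end_near. Qed.

Lemma line_solution (p M : R) (A h : R -> R) :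
  0 < p -> 0 < M ->
  continuous A -> continuous h -> (forall t, 0 <= A t) ->
  (forall t, 0 <= h t <= p * M) ->
  h t @[t --> +oo] --> 0 -> h t @[t --> -oo] --> 0 ->
  exists u u1 u2 : R -> R, [/\ C2_line u u1 u2,
    forall t, - u2 t + (p - 1) * u1 t + p * u t + A t * u t ^+ 2 = h t,
    u t @[t --> +oo] --> 0 & u t @[t --> -oo] --> 0].
Proof.
move=> p0 M0 cA ch A0 h0 /eventually_le_pinfty hsmall /eventually_le_ninfty hsmallN.
pose al (n : nat) : R := - n.+1%:R; pose be (n : nat) : R := n.+1%:R.
have albe n : al n < be n by rewrite (@lt_trans _ _ 0) ?oppr_lt0 ?ltr0n.
have al_dec n m : (n <= m)%N -> al m <= al n by rewrite lerN2 ler_nat.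
have [u [u1 [u2 [Su ual ube uM]]]] :=
  exhausting_solutions al be 0 1 p M A h albe (lexx 0) ltr01 p0 M0 cA ch A0 h0.
(* Mirror image of the decay at the right end, with rate p instead of 1. Choosing T1 <= 0 keeps it
   left of every [be n]. *)
have left_decay (e : R) : 0 < e -> exists T, T <= 0 /\
    forall n t, al n <= t <= T -> u n t <= e.
  move=> e0; have e20 : 0 < e / 2 by rewrite divr_gt0.
  have [T HT] := hsmallN _ (mulr_gt0 p0 e20).
  pose T1 := Num.min T 0.
  have [T1T T10] : T1 <= T /\ T1 <= 0 by rewrite !ge_min !lexx orbT.
  have x0 : 0 <= M / (p * (e / 2)) by rewrite divr_ge0 ?mulr_ge0// ltW.
  exists (T1 - M / (p * (e / 2))); split; first lra.
  move=> n t /andP[at_ tT].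
  have tT1 : t <= T1 by lra.
  have T1n : T1 <= be n by rewrite (le_trans T10)// ler0n.
  have /andP[_ uT1] : 0 <= u n T1 <= M by rewrite uM// T1n (le_trans at_).
  have uan : u n (al n) = 0 by have := ual n; lra.
  rewrite [leRHS](splitr e).
  apply: (le_trans (left_barrier _ _ _ T1 (al n) (e / 2) M _ _ _ p0 A0
    (semilinear_onS (lexx _) T1n (Su n)) (ltW e20) (ltW M0) uT1 uan _ _ _)).
  - by move=> s sT1; apply: HT; exact: le_trans T1T.
  - by rewrite at_.
  - by rewrite lerD2l expRN_small//; lra.
have left_small (e : R) : 0 < e -> exists n0, forall n m, (n0 <= n <= m)%N ->
    `|0 * u1 m (al n) - 1 * u m (al n)| <= 1 * e.
  move=> /left_decay[T [T0 HT]]; have [n0 Tn0] := natSr_unbounded (- T).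
  exists n0 => n m /andP[n0n nm].
  have anT : al n <= T by rewrite lerNl (le_trans Tn0)// ler_nat.
  have /andP[ua _] : 0 <= u m (al n) <= M.
    by rewrite uM// al_dec//= (le_trans anT)// (le_trans T0)// ler0n.
  by rewrite mul0r sub0r normrN !mul1r ger0_norm// HT// al_dec.
pose U t := lim (u ^~ t @ \oo).
have uniform := exhaustion_uniform p M 0 1 A h al be u u1 u2 p0 M0 (lexx 0) ltr01
  A0 albe al_dec natSr_ge natSr_unbounded Su ual ube uM hsmall left_small.
have bounds := exhaustion_bounds p M 0 1 A h al be u u1 u2 p0 M0 (lexx 0) ltr01
  A0 albe al_dec natSr_ge natSr_unbounded Su ual ube uM hsmall left_small.
have inI t : exists k, al k <= t <= be k.
  have [k tk] := natSr_unbounded `|t|; exists k.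
  by move: tk; rewrite ler_norml.
have local (t : R) : exists v v1 v2, semilinear_on p A h (t - 1) (t + 1) v v1 v2 /\
    \forall s \near t, v s = U s.
  have [k /andP[ak _]] := inI (t - 1); have [l /andP[_ bl]] := inI (t + 1).
  pose m := maxn k l.
  have am : al m <= t - 1 by rewrite (le_trans _ ak)// al_dec// leq_maxl.
  have bm : t + 1 <= be m by rewrite (le_trans bl)// ler_nat ltnS leq_maxr.
  have tt : t - 1 < t + 1 by lra.
  (* The point t - 1 is interior, so the Dirichlet form 0, 1 is used there. Its value - U (t - 1) is
     the limit of those of [u n], by uniform convergence alone. *)
  have [|v [v1 [v2 [Sv _ vU]]]] := exhaustion_local p M 0 1 A h al be u u1 u2 p0 M0
    (lexx 0) ltr01 A0 cA ch albe al_dec natSr_ge natSr_unbounded Su ual ube uM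
    hsmall left_small m (t - 1) (t + 1) 0 1 (- U (t - 1)) am bm tt (lexx 0) ltr01.
    move=> e /(uniform m)[n0 Hn0]; exists n0 => n n0n.
    rewrite mul0r sub0r mul1r opprK addrC distrC Hn0//.
    by rewrite am (le_trans _ bm)// ltW.
  exists v, v1, v2; split=> //; near=> s; rewrite vU//; apply/andP; split.
    by apply: ltW; near: s; apply: lt_nbhsr; rewrite ltrBlDr ltrDl.
  by apply: ltW; near: s; apply: lt_nbhsl; rewrite ltrDl.
exists U, (derive1 U), (derive1 (derive1 U)); split.
- apply: C2_line_glue => t; have [v [v1 [v2 [[C2v _] vU]]]] := local t.
  by exists v, v1, v2.
- move=> t; have [v [v1 [v2 [[C2v eqv] vU]]]] := local t.
  have [dw dw1 _] := C2_line_near C2v vU.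
  rewrite !derive1E (@derive_val _ _ _ _ _ _ _ dw) (@derive_val _ _ _ _ _ _ _ dw1).
  by rewrite -(nbhs_singleton vU) eqv//; lra.
- exact: exhaustion_decay p M 0 1 A h al be u u1 u2 p0 M0 (lexx 0) ltr01
    A0 albe al_dec natSr_ge natSr_unbounded Su ual ube uM hsmall left_small.
- apply/cvgrPdist_le => /= e e0; have e20 : 0 < e / 2 by rewrite divr_gt0.
  have [T [T0 HT]] := left_decay _ e20.
  exists T; split; first exact: num_real.
  move=> t tT; rewrite sub0r normrN.
  have [k kI] := inI t; have [n Hn] := uniform k _ e20.
  have := Hn (maxn n k) t (leq_maxl _ _) kI.
  have : u (maxn n k) t <= e / 2.
    case/andP: kI => ak _.
    by rewrite HT// (ltW tT) andbT (le_trans _ ak)// al_dec// leq_maxr.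
  have /andP[U0 _] := bounds _ _ kI; rewrite -/(U t) in U0 *.
  rewrite (ger0_norm U0) ler_norml => ? /andP[? ?]; lra.
Unshelve. all: by end_near. Qed.

End UnboundedIntervals.

(** * The forcing term *)

Section ForcingTerm.
Context {R : realType}.
Notation mu := (@lebesgue_measure R).

Lemma within_continuous_comp (a b : R) (f k : R -> R) :
  {within `[a, b], continuous f} -> continuous k ->
  (forall t, a <= k t <= b) -> continuous (f \o k).
Proof.
move=> /subspace_continuousP cf ck kab t.
have kI s : `[a, b]%classic (k s) by rewrite /= in_itv/= kab.
apply: (cvg_comp k f _ (cf _ (kI t))) => V kV.
have kV' : \forall s \near t, `[a, b]%classic (k s) -> V (k s) := ck t _ kV.
change (\forall s \near t, V (k s)).
by apply: filterS kV' => s; apply; exact: kI.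
Qed.

(** Replacing t by max(c, t) keeps the upper limit of integration inside [0, exp(-c)], where the
    integral of [g] is a continuous function of that limit. *)
Lemma Gterm_clamp_continuous (N : nat) (g : R -> R) (c : R) :
  mu.-integrable `[0, expR (- c)] (EFin \o g) ->
  continuous (fun t => Gterm N g (Num.max c t)).
Proof.
move=> ig.
have cmax : continuous (fun t : R => Num.max c t).
  move=> t; apply: (@continuous_max _ _ (fun=> c) id); first exact: cvg_cst.
  exact: cvg_id.
have cexp k : continuous (fun t : R => expR (k * Num.max c t)).
  move=> t; apply: (continuous_comp (g := fun s => expR (k * s))); first exact: cmax.
  exact: is_derive_line_continuous (is_derive_expRM k) _.
have ce : continuous (fun t : R => expR (- Num.max c t)).
  by move=> t; have := cexp (-1) t; under eq_fun do rewrite mulN1r.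
move=> t; apply: cvgM; first exact: cexp.
apply: (within_continuous_comp 0 (expR (- c))
  (fun x => \int[mu]_(s in `[0, x]) g s) _ _ ce).
  by apply: parameterized_integral_continuous; rewrite ?expR_ge0.
by move=> s; rewrite expR_ge0 ler_expR lerN2 le_max lexx.
Qed.

Lemma Gterm_ge0 (N : nat) (g : R -> R) (D : set (measurableTypeR R))
    (t : R) :
  `[0, expR (- t)] `<=` D -> mu.-integrable D (EFin \o g) ->
  measurable D ->
  {ae mu, forall x, D x -> 0 <= g x} -> 0 <= Gterm N g t.
Proof.
move=> sD ig mD g0; rewrite mulr_ge0 ?expR_ge0//.
have iS : mu.-integrable `[0, expR (- t)] (EFin \o g).
  exact: (integrableS mD (measurable_itv _) sD ig).
have mg := measurable_int mu iS.
(* As [g] is nonnegative only almost everywhere, it is exchanged for its positive part before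
   pointwise nonnegativity is invoked. *)
rewrite /Rintegral (@ae_eq_integral _ _ _ mu _ (fun x => (Num.max (g x) 0)%:E))//.
- by rewrite fine_ge0// integral_ge0// => x _; rewrite lee_fin le_max lexx orbT.
- apply/measurable_EFinP; apply: measurable_maxr => //.
  exact/measurable_EFinP.
- move: g0; apply: filterS => x + xt; move=> /(_ (sD _ xt)) gx.
  by rewrite /= max_l.
Qed.

Lemma bounded_of_ends (h : R -> R) (T1 T2 B1 B2 : R) : continuous h ->
  (forall t, t <= T1 -> h t <= B1) -> (forall t, T2 <= t -> h t <= B2) ->
  exists M, 0 < M /\ forall t, h t <= M.
Proof.
move=> ch h1 h2; pose a := Num.min T1 T2; pose b := Num.max T1 T2.
have ab : a <= b by rewrite ge_min !le_max !lexx.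
have [c _ cmax] := EVT_max ab (continuous_subspaceT ch).
exists (Num.max 1 (Num.max (h c) (Num.max B1 B2))); split.
  by rewrite lt_max ltr01.
move=> t; rewrite !le_max; have [ta|at_] := leP t T1; first by rewrite h1 ?orbT.
have [bt|tb] := leP T2 t; first by rewrite h2 ?orbT.
by rewrite cmax ?orbT// in_itv/= ge_min le_max (ltW at_) (ltW tb) orbT.
Qed.

Lemma ode_atN {N : nat} {lam : R} {g u u1 u2 : R -> R} {t : R} :
  - u2 t + (N%:R - 1 - 1) * u1 t + (N%:R - 1) * u t +
    (N%:R - 1) / 2 * expR (- t) * u t ^+ 2 = - lam * Gterm N g t ->
  ode_at N lam g (fun s => -1 * u s) (fun s => -1 * u1 s) (fun s => -1 * u2 s) t.
Proof.
move=> eq; rewrite /ode_at.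
have -> : lam * Gterm N g t = - (- lam * Gterm N g t) by ring.
rewrite -eq; ring.
Qed.

Lemma cvgN1_0 {F : set_system R} {FF : Filter F} {u : R -> R} :
  u @ F --> 0 -> (fun s => -1 * u s) @ F --> 0.
Proof. by move=> u0; rewrite -[X in _ --> X](mulr0 (-1)); apply: cvgM => //; exact: cvg_cst. Qed.

Lemma continuous_weight (k : R) : continuous (fun t : R => k * expR (- t)).
Proof.
move=> t; apply: cvgM; first exact: cvg_cst.
have := is_derive_line_continuous (is_derive_expRM (-1)) t.
by under eq_fun do rewrite mulN1r.
Qed.

Lemma halfline_ode (N : nat) (lam sg tau : R) (g : R -> R) :
  (2 <= N)%N -> lam < 0 -> 0 <= sg -> 0 < tau ->
  g_hyp (@measurable_01 R) g -> Gterm N g t @[t --> +oo] --> 0 ->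
  exists w w1 w2 : R -> R, [/\ C2_line w w1 w2,
    forall t, 0 <= t -> ode_at N lam g w w1 w2 t,
    sg * w1 0 - tau * w 0 = 0 & w t @[t --> +oo] --> 0].
Proof.
move=> N2 lam0 sg0 tau0 [ig [g0 _]] Gy.
have p0 : 0 < N%:R - 1 :> R by rewrite subr_gt0 ltr1n.
(* [g] is controlled on [0, 1] only, so [Gterm] is frozen at its value at 0 for
   negative [t]. *)
pose h t := - lam * Gterm N g (Num.max 0 t).
have ch : continuous h.
  move=> t; apply: cvgM; first exact: cvg_cst.
  by apply: Gterm_clamp_continuous; rewrite oppr0 expR0.
have h0 t : 0 <= h t.
  rewrite mulr_ge0 ?oppr_ge0 ?(ltW lam0)//.
  apply: (Gterm_ge0 _ _ _ _ _ ig (@measurable_01 R) g0).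
  move=> x; rewrite /= !in_itv/= => /andP[-> /le_trans]; apply.
  by rewrite -expR0 ler_expR oppr_le0 le_max lexx.
have hE t : 0 <= t -> h t = - lam * Gterm N g t by move=> t0; rewrite /h max_r.
have hy : h t @[t --> +oo] --> 0.
  have : - lam * Gterm N g t @[t --> +oo] --> 0.
    by rewrite -[X in _ --> X](mulr0 (- lam)); apply: cvgM => //; exact: cvg_cst.
  apply: cvg_trans; apply: near_eq_cvg; exists 0; split; first exact: num_real.
  by move=> t t0; rewrite hE// ltW.
have [T hT] := eventually_le_pinfty hy 1 ltr01.
have [|M [M0 hM]] := bounded_of_ends h 0 T (h 0) 1 ch _ hT.
  by move=> t t0; rewrite /h (max_l t0) maxxx lexx.
have hpM t : 0 <= h t <= (N%:R - 1) * (M / (N%:R - 1)).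
  by rewrite h0 mulrC divfK ?gt_eqF// hM.
have A0 t : 0 <= (N%:R - 1) / 2 * expR (- t) :> R.
  by rewrite mulr_ge0 ?expR_ge0// divr_ge0// ltW.
have [u [u1 [u2 [C2u equ lu u0]]]] := halfline_solution sg tau (N%:R - 1)
  (M / (N%:R - 1)) _ h sg0 tau0 p0 (divr_gt0 M0 p0) (continuous_weight _) ch A0
  hpM hy.
exists (fun s => -1 * u s), (fun s => -1 * u1 s), (fun s => -1 * u2 s); split.
- exact: C2_line_scale.
- by move=> t t0; apply: ode_atN; rewrite -hE// -equ.
- transitivity (-1 * (sg * u1 0 - tau * u 0)); first by ring.
  by rewrite lu mulr0.
- exact: cvgN1_0.
Qed.

Lemma line_ode (N : nat) (lam : R) (g : R -> R) :
  (2 <= N)%N -> lam < 0 -> g_hyp (@measurable_0oo R) g ->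
  Gterm N g t @[t --> +oo] --> 0 -> Gterm N g t @[t --> -oo] --> 0 ->
  exists w w1 w2 : R -> R, [/\ C2_line w w1 w2,
    forall t, ode_at N lam g w w1 w2 t,
    w t @[t --> +oo] --> 0 & w t @[t --> -oo] --> 0].
Proof.
move=> N2 lam0 [ig [g0 _]] Gy GNy.
have p0 : 0 < N%:R - 1 :> R by rewrite subr_gt0 ltr1n.
pose h t := - lam * Gterm N g t.
have ch : continuous h.
  move=> t; apply: cvgM; first exact: cvg_cst.
  have ct : t - 1 < t by rewrite ltrBlDr ltrDl.
  have ic : mu.-integrable `[0, expR (- (t - 1))] (EFin \o g).
    apply: integrableS ig => // x; rewrite /= !in_itv/= andbT.
    by case/andP.
  have := Gterm_clamp_continuous N g (t - 1) ic t.
  rewrite /continuous_at (max_r (ltW ct)); apply: cvg_trans; apply: near_eq_cvg.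
  by near=> s; rewrite max_r// ltW//; near: s; exact: lt_nbhsr.
have h0 t : 0 <= h t.
  rewrite mulr_ge0 ?oppr_ge0 ?(ltW lam0)//.
  apply: (Gterm_ge0 _ _ _ _ _ ig (@measurable_0oo R) g0).
  by move=> x; rewrite /= !in_itv/= andbT => /andP[].
have hcvg (F : set_system R) : Filter F -> Gterm N g @ F --> 0 -> h @ F --> 0.
  move=> FF G0; rewrite -[X in _ --> X](mulr0 (- lam)); apply: cvgM => //.
  exact: cvg_cst.
have hy : h t @[t --> +oo] --> 0 by exact: hcvg.
have hNy : h t @[t --> -oo] --> 0 by exact: hcvg.
have [T2 hT2] := eventually_le_pinfty hy 1 ltr01.
have [T1 hT1] := eventually_le_ninfty hNy 1 ltr01.
have [M [M0 hM]] := bounded_of_ends h T1 T2 1 1 ch hT1 hT2.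
have hpM t : 0 <= h t <= (N%:R - 1) * (M / (N%:R - 1)).
  by rewrite h0 mulrC divfK ?gt_eqF// hM.
have A0 t : 0 <= (N%:R - 1) / 2 * expR (- t) :> R.
  by rewrite mulr_ge0 ?expR_ge0// divr_ge0// ltW.
have [u [u1 [u2 [C2u equ uy uNy]]]] := line_solution (N%:R - 1)
  (M / (N%:R - 1)) _ h p0 (divr_gt0 M0 p0) (continuous_weight _) ch A0
  hpM hy hNy.
exists (fun s => -1 * u s), (fun s => -1 * u1 s), (fun s => -1 * u2 s); split.
- exact: C2_line_scale.
- by move=> t; apply: ode_atN; rewrite -/(h t) -equ.
- exact: cvgN1_0.
- exact: cvgN1_0.
Unshelve. all: by end_near. Qed.

Lemma C2_line_halfline (w w1 w2 : R -> R) :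
  C2_line w w1 w2 -> C2_halfline w w1 w2.
Proof.
move=> [dw cw2]; split=> [t _|]; first exact: dw.
split; first exact/continuous_subspaceT/(is_derive_line_continuous (fun t => (dw t).1)).
split; first exact/continuous_subspaceT/(is_derive_line_continuous (fun t => (dw t).2)).
exact: continuous_subspaceT.
Qed.

End ForcingTerm.

Theorem theorem4p15 (R : realType) (N : nat) (lam : R) :
  (2 <= N)%N -> lam < 0 ->
  (* (D) *)
  (forall g : R -> R,
     g_hyp (@measurable_01 R) g ->
     Gterm N g t @[t --> +oo] --> 0 ->
     exists w w1 w2 : R -> R,
       C2_halfline w w1 w2 /\ (forall t, 0 <= t -> ode_at N lam g w w1 w2 t) /\
       w 0 = 0 /\ w t @[t --> +oo] --> 0) /\
  (* (Nav) *)
  (forall g : R -> R,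
     g_hyp (@measurable_01 R) g ->
     Gterm N g t @[t --> +oo] --> 0 ->
     exists w w1 w2 : R -> R,
       C2_halfline w w1 w2 /\ (forall t, 0 <= t -> ode_at N lam g w w1 w2 t) /\
       w1 0 - (N%:R - 1) * w 0 = 0 /\ w t @[t --> +oo] --> 0) /\
  (* (E) *)
  (forall g : R -> R,
     g_hyp (@measurable_0oo R) g ->
     Gterm N g t @[t --> +oo] --> 0 ->
     Gterm N g t @[t --> -oo] --> 0 ->
     exists w w1 w2 : R -> R,
       C2_line w w1 w2 /\ (forall t, ode_at N lam g w w1 w2 t) /\
       w t @[t --> +oo] --> 0 /\ w t @[t --> -oo] --> 0).
Proof.
move=> N2 lam0; split; [|split].
- move=> g hg Gy.
  (* With sg = 0 and tau = 1 the Robin condition reads w(0) = 0. *)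
  have [w [w1 [w2 [C2w eqw lw wy]]]] := halfline_ode N lam 0 1 g N2 lam0
    (lexx 0) ltr01 hg Gy.
  exists w, w1, w2; split; first exact: C2_line_halfline.
  by split=> //; split=> //; lra.
- move=> g hg Gy; have p0 : 0 < N%:R - 1 :> R by rewrite subr_gt0 ltr1n.
  (* With sg = 1 and tau = N - 1, positive because N >= 2, the Robin condition is the Navier
     condition. *)
  have [w [w1 [w2 [C2w eqw lw wy]]]] := halfline_ode N lam 1 (N%:R - 1) g N2 lam0
    ler01 p0 hg Gy.
  exists w, w1, w2; split; first exact: C2_line_halfline.
  by split=> //; split=> //; rewrite mul1r in lw.
- move=> g hg Gy GNy.
  have [w [w1 [w2 [C2w eqw wy wNy]]]] := line_ode N lam g N2 lam0 hg Gy GNy.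
  by exists w, w1, w2.
Qed.
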